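(* Let $c \ge 4$ and write $c = 6s + t$ with $s \in \mathbb{N}_0$ and $t \in \{4,5,6,7,8,9\}$ (uniquely determined). Consider the Static Black-Peg AB Game with $p=3$ pegs and $c$ colors and the following list of questions. First take the base questions depending on $t$: $t=4$: $(1|2|3),(1|3|4),(3|2|4),(2|4|1)$; $t=5$: $(1|3|4),(2|3|4),(3|1|5),(4|2|5),(3|5|1),(4|5|3)$; $t=6$: $(1|2|3),(1|3|2),(2|1|3),(2|4|1),(3|5|2),(5|4|6),(6|5|4)$; $t=7$: $(1|2|7),(4|1|7),(2|7|5),(5|7|4),(7|3|2),(7|4|3),(6|5|1),(3|6|1),(3|5|6)$; $t=8$: $(6|5|4),(3|1|5),(7|6|4),(8|2|6),(2|4|6),(2|7|5),(4|1|3),(8|5|2),(1|6|7),(4|3|8)$; $t=9$: $(3|1|4),(2|1|3),(4|2|3),(1|2|4),(5|7|8),(5|6|7),(6|8|7),(7|5|8),(7|3|1),(7|3|5),(8|9|2),(8|4|9)$. Then, for each $l=1,\dots,s$, append the nine questions obtained from $(1|5|6),(4|1|6),(4|5|1),(2|6|4),(5|2|4),(5|6|2),(3|4|5),(6|3|5),(6|4|3)$ by adding $d_l=t+6(l-1)$ to every color. This list consists of exactly $\lfloor (3c-1)/2\rfloor-1$ questions, and it is a feasible and optimal $\lfloor (3c-1)/2 \rfloor$-strategy; that is, the answers to these questions uniquely determine every secret, and no feasible strategy consisting of fewer than $\lfloor (3c-1)/2\rfloor-1$ questions exists.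
   Context: Static Black-Peg AB Game with $p$ pegs and $c \ge p$ colors: the colors are $1,2,\dots,c$. A secret and a question are both ordered $p$-tuples $(x_1\,|\,x_2\,|\,\dots\,|\,x_p)$ of pairwise distinct colors. The answer to a question $Q=(q_1\,|\,\dots\,|\,q_p)$ for a secret $S=(s_1\,|\,\dots\,|\,s_p)$ is the number of positions (pegs) $i$ with $q_i=s_i$. A strategy is a list of $k$ pairwise distinct questions (the main questions) which the codebreaker asks all at once at the beginning; it is called a $(k+1)$-strategy (the extra one counting the final question, which is the secret itself). The strategy is feasible if any two distinct secrets receive different vectors of answers to the $k$ questions. A $(k+1)$-strategy is optimal if it is feasible and there is no feasible strategy with fewer than $k$ questions. *)

(* Defs.v *)
From mathcomp Require Import all_boot.

Set Implicit Arguments.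
Unset Strict Implicit.
Unset Printing Implicit Defensive.

Section Game.

Variables p c : nat.

(* The colors are the natural numbers 1, ..., c. *)
Definition is_code (x : p.-tuple nat) : bool :=
  uniq x && all (fun a => 1 <= a <= c) x.

Definition answer (Q S : p.-tuple nat) : nat :=
  #|[set i : 'I_p | tnth Q i == tnth S i]|.

Definition strategy (qs : seq (p.-tuple nat)) : Prop :=
  all is_code qs /\ uniq qs.

(* The final question, which is the secret itself, is counted but not listed. *)
Definition n_strategy (n : nat) (qs : seq (p.-tuple nat)) : Prop :=
  strategy qs /\ (size qs).+1 = n.

Definition feasible (qs : seq (p.-tuple nat)) : Prop :=
  forall S S' : p.-tuple nat, is_code S -> is_code S' -> S <> S' ->
    [seq answer Q S | Q <- qs] <> [seq answer Q S' | Q <- qs].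

Definition optimal (qs : seq (p.-tuple nat)) : Prop :=
  feasible qs /\
  ~ (exists qs' : seq (p.-tuple nat),
       [/\ strategy qs', feasible qs' & size qs' < size qs]).

End Game.

Definition code3 (x y z : nat) : 3.-tuple nat := [tuple x; y; z].

Definition base_questions (t : nat) : seq (3.-tuple nat) :=
  match t with
  | 4 => [:: code3 1 2 3; code3 1 3 4; code3 3 2 4; code3 2 4 1]
  | 5 => [:: code3 1 3 4; code3 2 3 4; code3 3 1 5; code3 4 2 5; code3 3 5 1;
             code3 4 5 3]
  | 6 => [:: code3 1 2 3; code3 1 3 2; code3 2 1 3; code3 2 4 1; code3 3 5 2;
             code3 5 4 6; code3 6 5 4]
  | 7 => [:: code3 1 2 7; code3 4 1 7; code3 2 7 5; code3 5 7 4; code3 7 3 2;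
             code3 7 4 3; code3 6 5 1; code3 3 6 1; code3 3 5 6]
  | 8 => [:: code3 6 5 4; code3 3 1 5; code3 7 6 4; code3 8 2 6; code3 2 4 6;
             code3 2 7 5; code3 4 1 3; code3 8 5 2; code3 1 6 7; code3 4 3 8]
  | 9 => [:: code3 3 1 4; code3 2 1 3; code3 4 2 3; code3 1 2 4; code3 5 7 8;
             code3 5 6 7; code3 6 8 7; code3 7 5 8; code3 7 3 1; code3 7 3 5;
             code3 8 9 2; code3 8 4 9]
  | _ => [::] (* unused: only 4 <= t <= 9 occurs *)
  end.

Definition block_questions : seq (3.-tuple nat) :=
  [:: code3 1 5 6; code3 4 1 6; code3 4 5 1; code3 2 6 4; code3 5 2 4;
      code3 5 6 2; code3 3 4 5; code3 6 3 5; code3 6 4 3].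

Definition shift (d : nat) (Q : 3.-tuple nat) : 3.-tuple nat :=
  [tuple of map (addn d) Q].

Definition questions (s t : nat) : seq (3.-tuple nat) :=
  base_questions t ++
  flatten [seq [seq shift (t + 6 * (l - 1)) Q | Q <- block_questions]
          | l <- iota 1 s].

(* Main.v *)
Require Import Defs.
From mathcomp Require Import all_boot zify.

Set Implicit Arguments.
Unset Strict Implicit.
Unset Printing Implicit Defensive.

(* Lower bound. On each peg, send a color to the set of questions that have it
   on that peg. Feasibility says that a code is determined by the multiset of
   its three sets. If c >= 5, swapping sets between pegs shows that two pegs
   have at most three sets in common (and three only when these link their
   colors in a directed triangle), and that the three pairs of pegs have at
   most six common sets altogether. The sets have total size 3k for k
   questions; all but the empty set and the singletons have size at least 2,
   and a singleton or empty set occurring on several pegs is a common set.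
   Hence 6c <= 4k + 9. If c = 4 and k <= 3, no color occurs twice on a peg, so
   the 24 codes have answer vectors of sum at most 3, of which there are 20.

   Feasibility. The colors of the blocks are disjoint, so each block of
   questions sees a code through a partial code on its own colors. The answers
   to the nine questions of a block determine all partial codes on six colors,
   and the answers to the base questions determine the partial codes with
   a given set of empty pegs. *)

Lemma fresh (T : finType) (s : seq T) : size s < #|T| -> exists v, v \notin s.
Proof.
move=> lt_s; apply/existsP; apply: contraLR lt_s => /existsPn s_all.
rewrite -leqNgt (leq_trans _ (card_size s)) //; apply: subset_leq_card.
by apply/subsetP=> v _; rewrite -[_ \in _]negbK s_all.
Qed.

(** * Sets common to several pegs *)

Section Common.

Variables (T V : finType) (f g : T -> V).

Definition common : {set V} := [set f x | x in T] :&: [set g x | x in T].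

Lemma commonP w : reflect (exists x y, f x = w /\ g y = w) (w \in common).
Proof.
apply: (iffP setIP) => [[/imsetP[x _ ->] /imsetP[y _ e]] | [x [y [<- e]]]].
  by exists x, y.
by split; [apply: imset_f | rewrite -e; apply: imset_f].
Qed.

(* Read [f x = g y] as an edge from [x] to [y]. *)
Definition consecutive := [/\ injective f, injective g &
  forall x x' y y', f x = g y -> f x' = g y' -> x <> x' -> x = y' \/ x' = y].

Definition triangle x y z :=
  [/\ uniq [:: x; y; z], f x = g y, f y = g z & f z = g x].

Lemma triangle_rot x y z : triangle x y z -> triangle y z x.
Proof. by case=> u *; split=> //; move: u; rewrite -(rot_uniq 1). Qed.

Hypothesis fg : consecutive.

(** Any other edge starts in [y], giving [f y], or ends in [x], giving [g x]. *)
Lemma common_sub x y : f x = g y -> common \subset [set f x; f y; g x].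
Proof.
case: fg => fI gI cons e; apply/subsetP=> w /commonP[x' [y' [<- e']]].
rewrite !inE; have [->|/eqP ne] := eqVneq x' x; first by rewrite eqxx.
have [->|->] := cons _ _ _ _ (esym e') e ne; first by rewrite eqxx !orbT.
by rewrite -e' eqxx !orbT.
Qed.

Lemma card_set3 (a b c : V) : #|[set a; b; c]| <= 3.
Proof. by rewrite !cardsU !cards1; lia. Qed.

Lemma common_le3 : #|common| <= 3.
Proof.
have [->|[w /commonP[x [y [fx gy]]]]] := set_0Vmem common; first by rewrite cards0.
have e : f x = g y by rewrite fx.
exact: leq_trans (subset_leq_card (common_sub e)) (card_set3 _ _ _).
Qed.

(** The three candidates of [common_sub] are now distinct common sets, so some edge leaves [y] and
    some edge enters [x]. These two are consecutive, which closes the triangle. *)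
Lemma common_triangle : 2 < #|common| ->
  exists x y z, triangle x y z /\ common = [set f x; f y; f z].
Proof.
move=> gt2; have [w /commonP[x [y [fx gy]]]]: exists w, w \in common.
  by apply/set0Pn; rewrite -card_gt0; lia.
have e : f x = g y by rewrite fx.
have sub := common_sub e.
have eqC : common = [set f x; f y; g x].
  by apply/eqP; rewrite eqEcard sub (leq_trans (card_set3 _ _ _)).
have : f y \in common by rewrite eqC !inE eqxx orbT.
have : g x \in common by rewrite eqC !inE eqxx !orbT.
case/commonP=> z [_ [fz _]] /commonP[_ [z' [_ gz']]].
case: fg => fI gI cons.
have ne_xy : x != y.
  by apply: contraL gt2 => /eqP xy; rewrite eqC xy setUid cards2; lia.
have ne_zy : z <> y.
  by move=> zy; move: gt2; rewrite eqC -fz zy -setUA setUid cards2; lia.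
have [zz|/eqP] := cons _ _ _ _ fz (esym gz') ne_zy; last first.
  by rewrite eq_sym (negPf ne_xy).
subst z'; exists x, y, z; rewrite fz; split=> //; split=> //=.
rewrite !inE negb_or ne_xy /= andbT; apply/andP; split; last first.
  by rewrite eq_sym; apply/eqP.
apply/eqP=> xz; move: gt2; rewrite eqC -fz -xz.
by rewrite setUAC setUid cards2; lia.
Qed.

End Common.

Lemma commonC (T V : finType) (f g : T -> V) : common f g = common g f.
Proof. by rewrite /common setIC. Qed.

(** * Separating triples of maps *)

Section Separating.

Variables (T V : finType).
Implicit Types f : T -> V.

(* With [f i x] the set of questions having color [x] on peg [i], two codes get
   the same answers as soon as their multisets of sets agree. *)
Definition separating f1 f2 f3 := forall a1 a2 a3 b1 b2 b3,
  uniq [:: a1; a2; a3] -> uniq [:: b1; b2; b3] ->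
  perm_eq [:: f1 a1; f2 a2; f3 a3] [:: f1 b1; f2 b2; f3 b3] ->
  [/\ a1 = b1, a2 = b2 & a3 = b3].

Lemma uniq3 (a b c : T) : uniq [:: a; b; c] = [&& a != b, a != c & b != c].
Proof. by rewrite /= !inE andbT negb_or -andbA. Qed.

Lemma uniq3P (a b c : T) :
  reflect [/\ a <> b, a <> c & b <> c] (uniq [:: a; b; c]).
Proof. by rewrite uniq3; apply: (iffP and3P) => -[/eqP ? /eqP ? /eqP ?]. Qed.

Lemma separating_swap12 f1 f2 f3 :
  separating f1 f2 f3 -> separating f2 f1 f3.
Proof.
move=> sep a1 a2 a3 b1 b2 b3 ua ub; move/permP=> p.
have [|||-> -> ->] // := sep a2 a1 a3 b2 b1 b3.
- by move: ua; rewrite !uniq3 (eq_sym a1 a2); case/and3P=> -> -> ->.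
- by move: ub; rewrite !uniq3 (eq_sym b1 b2); case/and3P=> -> -> ->.
- by apply/permP=> P; move: (p P) => /=; lia.
Qed.

Lemma separating_swap23 f1 f2 f3 :
  separating f1 f2 f3 -> separating f1 f3 f2.
Proof.
move=> sep a1 a2 a3 b1 b2 b3 ua ub; move/permP=> p.
have [|||-> -> ->] // := sep a1 a3 a2 b1 b3 b2.
- by move: ua; rewrite !uniq3 (eq_sym a2 a3); case/and3P=> -> -> ->.
- by move: ub; rewrite !uniq3 (eq_sym b2 b3); case/and3P=> -> -> ->.
- by apply/permP=> P; move: (p P) => /=; lia.
Qed.

(** If [x] and [y] shared a set, two further colors on the other pegs would complete them to codes
    with the same sets. *)
Lemma separating_inj f1 f2 f3 :
  3 < #|T| -> separating f1 f2 f3 -> injective f1.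
Proof.
move=> cT sep x y e.
have [a] := @fresh T [:: x; y] (ltnW cT); rewrite !inE negb_or => /andP[ax ay].
have [b] := @fresh T [:: x; y; a] cT; rewrite !inE !negb_or => /and3P[bx by_ ba].
have [] // := sep x a b y a b; rewrite ?uniq3 ?e ?perm_refl //.
  by rewrite eq_sym ax eq_sym bx eq_sym ba.
by rewrite eq_sym ay eq_sym by_ eq_sym ba.
Qed.

(** The codes [(x|y'|v)] and [(x'|y|v)] carry the same sets, so one of them must repeat a color.
    Keeping [v] off the other four colors takes a fifth one. *)
Lemma separating_consecutive f1 f2 f3 :
  4 < #|T| -> separating f1 f2 f3 -> consecutive f1 f2.
Proof.
move=> cT sep.
have f1I := separating_inj (ltnW cT) sep.
have f2I := separating_inj (ltnW cT) (separating_swap12 sep).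
split=> // x x' y y' e e' ne.
have [->|nxy] := eqVneq x y'; first by left.
have [->|nxy'] := eqVneq x' y; first by right.
have [v] := @fresh T [:: x; x'; y; y'] cT.
rewrite !inE !negb_or => /and4P[vx vx' vy vy'].
case: ne; have [] // := sep x y' v x' y v.
- by rewrite uniq3 nxy eq_sym vx eq_sym vy'.
- by rewrite uniq3 nxy' eq_sym vx' eq_sym vy.
- by apply/permP=> P /=; rewrite e e'; lia.
Qed.

End Separating.

(** * Pairs of pegs with three common sets *)

Section Triangle.

Variables (T V : finType) (f1 f2 f3 : T -> V).
Hypotheses (sep : separating f1 f2 f3).
Hypotheses (cons12 : consecutive f1 f2) (cons13 : consecutive f1 f3).
Hypothesis (cons23 : consecutive f2 f3).

Let f1I : injective f1. Proof. by case: cons12. Qed.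
Let f2I : injective f2. Proof. by case: cons12. Qed.
Let f3I : injective f3. Proof. by case: cons13. Qed.

(** The codes [(a|p|q)] and [(r|s|b)] carry the same three sets, moved cyclically between the
    pegs. *)
Lemma exchange r p s q a b :
    f1 r = f2 p -> f2 s = f3 q -> f1 a = f3 b ->
    [/\ a <> p, a <> q & p <> q] -> [/\ r <> s, r <> b & s <> b] ->
  [/\ a = r, p = s & q = b].
Proof.
move=> e12 e23 e13 /uniq3P u /uniq3P u'; apply: sep => //.
by apply/permP=> P /=; rewrite e12 e23 e13; lia.
Qed.

(** Consecutiveness with peg 3 leaves only [b = z] and [b' = x]; then [(y|x|z)] and [(z|y|x)] carry
    the same sets. *)
Lemma two_shared x y z b b' :
  triangle f1 f2 x y z -> f1 x = f3 b -> f1 y = f3 b' -> False.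
Proof.
case=> /uniq3P[nxy nxz nyz] e1 e2 e3 xb yb'.
have [_ _ c13] := cons13; have [_ _ c23] := cons23.
have bb' : b <> b' by move=> E; apply/nxy/f1I; congruence.
have yb : f2 y = f3 b by congruence.
have zb' : f2 z = f3 b' by congruence.
have h1 := c13 _ _ _ _ xb yb' nxy.
have h2 := c23 _ _ _ _ yb zb' nyz.
have [xb'' zb''] : b' = x /\ b = z.
  by case: h1 => h1; case: h2 => h2; split; congruence.
subst b b'.
have [] // := exchange e3 yb yb'; split; congruence.
Qed.

Section Fixed.

Variables x y z : T.
Hypothesis xyz : triangle f1 f2 x y z.
Local Notation outside a := [/\ a <> x, a <> y & a <> z].

(* Each of the three edges of the triangle would give an exchange, unless it
   ends in [q] or starts in [d]; these exclude at most two of the edges. *)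
Lemma cross a d s q :
  f1 a = f3 d -> f2 s = f3 q -> outside a -> outside s -> a = q \/ s = d.
Proof.
case: xyz => /uniq3P[nxy nxz nyz] e1 e2 e3 ad sq [nax nay naz] [nsx nsy nsz].
have [|/eqP naq] := eqVneq a q; [by left|right].
have [//|/eqP nsd] := eqVneq s d; exfalso.
have step r p : f1 r = f2 p -> a <> p -> a <> r -> s <> r -> p = q \/ r = d.
  move=> rp nap nar nsr.
  have [|/eqP npq] := eqVneq p q; [by left|right].
  have [//|/eqP nrd] := eqVneq r d; case: nar.
  by have [] := exchange rp sq ad; first 2 [by split=> //; apply: nesym].
have [] := step _ _ e1 nay nax nsx; have [] := step _ _ e2 naz nay nsy;
  have [] := step _ _ e3 nax naz nsz; congruence.
Qed.

Lemma outside13 w : common f1 f2 = [set f1 x; f1 y; f1 z] ->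
  w \in common f1 f3 :\: common f1 f2 ->
  exists a d, [/\ f1 a = w, f1 a = f3 d & outside a].
Proof.
move=> eqA /setDP[/commonP[a [d [aw dw]]]].
rewrite eqA !inE !negb_or -!andbA => /and3P[/eqP ? /eqP ? /eqP ?].
by exists a, d; split; [| |split]; congruence.
Qed.

Lemma outside23 w : common f1 f2 = [set f1 x; f1 y; f1 z] ->
  w \in common f2 f3 :\: common f1 f2 ->
  exists s q, [/\ f2 s = w, f2 s = f3 q & outside s].
Proof.
case: xyz => u e1 e2 e3 eqA /setDP[/commonP[s [q [sw qw]]]].
rewrite eqA !inE !negb_or -!andbA => /and3P[/eqP ? /eqP ? /eqP ?].
by exists s, q; split; [| |split]; congruence.
Qed.

(* The set of [x] on peg 1, which is that of [y] on peg 2, also occurs on peg 3. *)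
Section Shared.

Variable b : T.
Hypothesis xb : f1 x = f3 b.

(** The codes [(a|x|b)] and [(z|y|x)] carry the same sets. *)
Lemma shared_pred13 a : f1 a = f3 x -> outside a -> outside b -> a <> b -> False.
Proof.
case: xyz => /uniq3P[nxy nxz nyz] e1 e2 e3 ax [nax nay naz] [nbx nby nbz] nab.
have yb : f2 y = f3 b by congruence.
by have [] := exchange e3 yb ax; try split; congruence.
Qed.

(** The codes [(x|z|y)] and [(y|s|b)] carry the same sets. *)
Lemma shared_pred23 s : f2 s = f3 y -> outside s -> outside b -> s <> b -> False.
Proof.
case: xyz => /uniq3P[nxy nxz nyz] e1 e2 e3 sy [nax nay naz] [nbx nby nbz] nab.
by have [] := exchange e2 sy xb; try split; congruence.
Qed.

(** Both edges are consecutive to the edge from [x] to [b]. By injectivity one starts in [b] and the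
    other ends in [x], which [shared_pred13] excludes. *)
Lemma shared_two13 a d a' d' : f1 a = f3 d -> f1 a' = f3 d' ->
  outside a -> outside a' -> a <> a' -> False.
Proof.
move=> ad ad' oa oa' naa.
have [_ _ c13] := cons13.
have nad : x <> a by case: oa; congruence.
have nad' : x <> a' by case: oa'; congruence.
have h := c13 _ _ _ _ xb ad nad; have h' := c13 _ _ _ _ xb ad' nad'.
have ndd : d <> d' by move=> E; apply/naa/f1I; congruence.
case: (oa) => ? ? ?; case: (oa') => ? ? ?.
case: h => h; case: h' => h'; try congruence.
- by apply: (@shared_pred13 a); try split; congruence.
- by apply: (@shared_pred13 a'); try split; congruence.
Qed.

Lemma shared_two23 s q s' q' : f2 s = f3 q -> f2 s' = f3 q' ->
  outside s -> outside s' -> s <> s' -> False.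
Proof.
move=> sq sq' os os' nss.
have [_ _ c23] := cons23.
have yb : f2 y = f3 b by case: xyz; congruence.
have ns : y <> s by case: os; congruence.
have ns' : y <> s' by case: os'; congruence.
have h := c23 _ _ _ _ yb sq ns; have h' := c23 _ _ _ _ yb sq' ns'.
have nqq : q <> q' by move=> E; apply/nss/f2I; congruence.
case: (os) => ? ? ?; case: (os') => ? ? ?.
case: h => h; case: h' => h'; try congruence.
- by apply: (@shared_pred23 s); try split; congruence.
- by apply: (@shared_pred23 s'); try split; congruence.
Qed.

(** Consecutiveness and [cross] leave two cases: [d = x] with [s = b], or [q = y] with [a = b]. *)
Lemma shared_one13_one23 a d s q : f1 a = f3 d -> f2 s = f3 q ->
  outside a -> outside s -> False.
Proof.
move=> ad sq oa os.
have [_ _ c13] := cons13; have [_ _ c23] := cons23.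
have yb : f2 y = f3 b by case: xyz; congruence.
have nxa : x <> a by case: oa; congruence.
have nys : y <> s by case: os; congruence.
have h := c13 _ _ _ _ xb ad nxa; have h' := c23 _ _ _ _ yb sq nys.
have c := cross ad sq oa os.
have ndb : d <> b by move=> E; apply/nxa/f1I; congruence.
have nqb : q <> b by move=> E; apply/nys/f2I; congruence.
case: (oa) => ? ? ?; case: (os) => ? ? ?.
case: h => h; case: h' => h'; case: c => c; try congruence.
- by apply: (@shared_pred13 a); try split; congruence.
- by apply: (@shared_pred23 s); try split; congruence.
Qed.

Lemma shared_card :
  common f1 f2 = [set f1 x; f1 y; f1 z] ->
  #|common f1 f3 :\: common f1 f2| + #|common f2 f3 :\: common f1 f2| <= 1.
Proof.
move=> eqA; set B := _ :\: _; set C := _ :\: _.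
have [leB|/card_gt1P[w [w' [wB w'B /eqP ne]]]] := leqP #|B| 1; last first.
  have [a [d [aw ad oa]]] := outside13 eqA wB.
  have [a' [d' [aw' ad' oa']]] := outside13 eqA w'B.
  by case: (shared_two13 ad ad' oa oa'); congruence.
have [leC|/card_gt1P[w [w' [wC w'C /eqP ne]]]] := leqP #|C| 1; last first.
  have [s [q [sw sq os]]] := outside23 eqA wC.
  have [s' [q' [sw' sq' os']]] := outside23 eqA w'C.
  by case: (shared_two23 sq sq' os os'); congruence.
have [B0|/card_gt0P[w wB]] := posnP #|B|; first by rewrite B0.
have [C0|/card_gt0P[w' w'C]] := posnP #|C|; first by rewrite C0 addn0.
have [a [d [aw ad oa]]] := outside13 eqA wB.
have [s [q [sw sq os]]] := outside23 eqA w'C.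
by case: (shared_one13_one23 ad sq oa os).
Qed.

End Shared.

Lemma unshared_card :
  common f1 f2 = [set f1 x; f1 y; f1 z] ->
  #|common f1 f3 :\: common f1 f2| + #|common f2 f3 :\: common f1 f2| <= 3.
Proof.
move=> eqA; set B := _ :\: _; set C := _ :\: _.
have leB3 : #|common f1 f3| <= 3 := common_le3 cons13.
have leC3 : #|common f2 f3| <= 3 := common_le3 cons23.
have sB : B \subset common f1 f3 by rewrite subsetDl.
have sC : C \subset common f2 f3 by rewrite subsetDl.
have cB := subset_leq_card sB; have cC := subset_leq_card sC.
rewrite leqNgt; apply/negP => gt3.
(* As neither part exceeds three, one has three sets and the other at least one, or both have
   two. *)
have [gB|leB] := ltnP 2 #|B|.
  have eB : B = common f1 f3 by apply/eqP; rewrite eqEcard sB (leq_trans leB3).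
  have [|a1 [a2 [a3 [[u t1 t2 t3] eqB]]]] := common_triangle cons13.
    by rewrite -eB.
  have /card_gt0P[w wC] : 0 < #|C| by lia.
  have [s [q [_ sq os]]] := outside23 eqA wC.
  have out a : f1 a \in B -> outside a.
    by case/(outside13 eqA)=> a' [d [aa _]]; rewrite (f1I aa).
  rewrite -eB in eqB.
  have o1 : outside a1 by apply: out; rewrite eqB !inE eqxx.
  have o2 : outside a2 by apply: out; rewrite eqB !inE eqxx ?orbT.
  have o3 : outside a3 by apply: out; rewrite eqB !inE eqxx ?orbT.
  (* The tails differ and so do the heads, so each of the two alternatives of [cross] serves at most
     one of the three edges. *)
  have := cross t1 sq o1 os; have := cross t2 sq o2 os; have := cross t3 sq o3 os.
  by move: u => /uniq3P[? ? ?]; do 3 case=> ?; congruence.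
have [gC|leC] := ltnP 2 #|C|.
  have eC : C = common f2 f3 by apply/eqP; rewrite eqEcard sC (leq_trans leC3).
  have [|a1 [a2 [a3 [[u t1 t2 t3] eqC]]]] := common_triangle cons23.
    by rewrite -eC.
  have /card_gt0P[w wB] : 0 < #|B| by lia.
  have [a [d [_ ad oa]]] := outside13 eqA wB.
  have out s : f2 s \in C -> outside s.
    by case/(outside23 eqA)=> s' [q [ss _]]; rewrite (f2I ss).
  rewrite -eC in eqC.
  have o1 : outside a1 by apply: out; rewrite eqC !inE eqxx.
  have o2 : outside a2 by apply: out; rewrite eqC !inE eqxx ?orbT.
  have o3 : outside a3 by apply: out; rewrite eqC !inE eqxx ?orbT.
  have := cross ad t1 oa o1; have := cross ad t2 oa o2; have := cross ad t3 oa o3.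
  by move: u => /uniq3P[? ? ?]; do 3 case=> ?; congruence.
have /card_gt1P[w [w' [wB w'B /eqP nw]]] : 1 < #|B| by lia.
have /card_gt1P[v [v' [vC v'C /eqP nv]]] : 1 < #|C| by lia.
have [a [d [aw ad oa]]] := outside13 eqA wB.
have [a' [d' [aw' ad' oa']]] := outside13 eqA w'B.
have [s [q [sw sq os]]] := outside23 eqA vC.
have [s' [q' [sw' sq' os']]] := outside23 eqA v'C.
have naa : a <> a' by congruence.
have nss : s <> s' by congruence.
have ndd : d <> d' by congruence.
have nqq : q <> q' by congruence.
have [_ _ c13] := cons13; have [_ _ c23] := cons23.
(* The crossings match [a], [a'] with [q], [q'] and [s], [s'] with [d], [d']; consecutiveness then
   merges two distinct tails. *)
have := cross ad sq oa os; have := cross ad sq' oa os'.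
have := cross ad' sq oa' os; have := cross ad' sq' oa' os'.
have := c13 _ _ _ _ ad ad' naa; have := c23 _ _ _ _ sq sq' nss.
by do 6 case=> ?; congruence.
Qed.

End Fixed.

(** The sets on all three pegs form [A], which has at most one element by [two_shared] and counts in
    both summands. The sum is at most 0 + 3 if [A] is empty and 2 + 1 otherwise. *)
Lemma common_triangle_sum :
  2 < #|common f1 f2| -> #|common f1 f3| + #|common f2 f3| <= 3.
Proof.
case/(common_triangle cons12) => x [y [z [xyz eqA]]].
have yzx := triangle_rot xyz; have zxy := triangle_rot yzx.
pose A := common f1 f2 :&: [set f3 x | x in T].
have cB : #|common f1 f3| = #|A| + #|common f1 f3 :\: common f1 f2|.
  rewrite -(cardsID (common f1 f2) (common f1 f3)).
  suff <- : common f1 f3 :&: common f1 f2 = A by [].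
  by apply/setP=> w; rewrite !inE; do !case: (w \in _).
have cC : #|common f2 f3| = #|A| + #|common f2 f3 :\: common f1 f2|.
  rewrite -(cardsID (common f1 f2) (common f2 f3)).
  suff <- : common f2 f3 :&: common f1 f2 = A by [].
  by apply/setP=> w; rewrite !inE; do !case: (w \in _).
have leA : #|A| <= 1.
  rewrite leqNgt; apply/card_gt1P => -[w [w' []]].
  rewrite /A eqA !inE -!orbA.
  case/andP=> wt /imsetP[b _ wb]; case/andP=> wt' /imsetP[b' _ wb'] /eqP nww.
  by case/or3P: wt => /eqP ?; case/or3P: wt' => /eqP ?; first [congruence |
     by apply: (two_shared xyz (b := b) (b' := b')); congruence |
     by apply: (two_shared xyz (b := b') (b' := b)); congruence |
     by apply: (two_shared yzx (b := b) (b' := b')); congruence |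
     by apply: (two_shared yzx (b := b') (b' := b)); congruence |
     by apply: (two_shared zxy (b := b) (b' := b')); congruence |
     by apply: (two_shared zxy (b := b') (b' := b)); congruence].
have eqA' : common f1 f2 = [set f1 y; f1 z; f1 x] by rewrite eqA -setUA setUC.
have eqA'' : common f1 f2 = [set f1 z; f1 x; f1 y] by rewrite eqA' -setUA setUC.
have := unshared_card xyz eqA.
have [A0|/card_gt0P[w]] := posnP #|A|; first by rewrite cB cC A0.
rewrite {1}/A {1}eqA !inE -!orbA => /andP[wt /imsetP[b _ wb]] _.
suff : #|common f1 f3 :\: common f1 f2| + #|common f2 f3 :\: common f1 f2| <= 1.
  by lia.
case/or3P: wt => /eqP wt.
- by apply: (shared_card xyz (b := b)) => //; congruence.
- by apply: (shared_card yzx (b := b)) => //; congruence.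
- by apply: (shared_card zxy (b := b)) => //; congruence.
Qed.

End Triangle.

(** If one pair of pegs has three common sets, [common_triangle_sum] leaves three for the other two
    pairs; otherwise each pair has at most two. *)
Lemma card_common_sum (T V : finType) (f1 f2 f3 : T -> V) :
  4 < #|T| -> separating f1 f2 f3 ->
  #|common f1 f2| + #|common f1 f3| + #|common f2 f3| <= 6.
Proof.
move=> cT sep123.
have sep213 := separating_swap12 sep123; have sep132 := separating_swap23 sep123.
have sep231 := separating_swap23 sep213; have sep312 := separating_swap12 sep132.
have sep321 := separating_swap12 sep231.
have c12 := separating_consecutive cT sep123.
have c21 := separating_consecutive cT sep213.
have c13 := separating_consecutive cT sep132.
have c31 := separating_consecutive cT sep312.
have c23 := separating_consecutive cT sep231.
have c32 := separating_consecutive cT sep321.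
have := common_le3 c12; have := common_le3 c13; have := common_le3 c23.
have := common_triangle_sum sep123 c12 c13 c23.
have := common_triangle_sum sep132 c13 c12 c32.
have := common_triangle_sum sep231 c23 c21 c31.
rewrite (commonC f3 f2) (commonC f2 f1) (commonC f3 f1); lia.
Qed.

(** * The lower bound *)

Section Counting.

Variable k : nat.
Implicit Types I : {set {set 'I_k}}.

Definition singletons I : {set 'I_k} := [set q | [set q] \in I].

Lemma card_singletons I : (set0 \in I) + #|singletons I| <= #|I|.
Proof.
rewrite (cardsD1 set0) leq_add2l -(card_imset _ (@set1_inj 'I_k)).
apply/subset_leq_card/subsetP=> w /imsetP[q]; rewrite !inE => qI ->.
by rewrite qI andbT; apply/set0Pn; exists q; rewrite inE.
Qed.

(** This sums [2 <= #|w| + 2 * (w == set0) + (#|w| == 1)] over [I]. *)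
Lemma card_le_weight I :
  \sum_(w in I) #|w| <= k -> 2 * #|I| <= k + 2 * (set0 \in I) + #|singletons I|.
Proof.
move=> le_k.
have -> : 2 * (set0 \in I) = \sum_(w in I) 2 * (w == set0).
  rewrite -big_distrr /=; congr (2 * _).
  case: (boolP (set0 \in I)) => [I0|/negP I0].
    by rewrite (bigD1 set0) //= eqxx big1 // => w /andP[_ /negPf->].
  by rewrite big1 // => w wI; case: eqP => // w0; rewrite -w0 in I0.
have -> : #|singletons I| = \sum_(w in I) (#|w| == 1).
  rewrite -(card_imset _ (@set1_inj 'I_k)) -sum1_card [RHS]big_mkcond /=.
  rewrite big_mkcond; apply: eq_bigr => w _; apply/esym.
  case: imsetP => [[q]|nw]; first by rewrite inE => qI ->; rewrite qI cards1.
  case: ifP => // wI; case: eqP => // /eqP/cards1P[q wq].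
  by case: nw; exists q => //; rewrite inE -wq.
rewrite -sum1_card big_distrr /=.
apply: leq_trans (leq_add (leq_add le_k (leqnn _)) (leqnn _)).
rewrite -!big_split; apply: leq_sum => w _ /=.
by rewrite -cards_eq0; case: #|w| => [|[|n]].
Qed.

(** Inclusion-exclusion bounds the singletons of the three pegs by [k] plus those in the pairwise
    intersections. The empty set adds 2 for each peg having it, but is itself one common set for
    each pair of such pegs: a net gain of 0, 2, 3 or 3. *)
Lemma three_pegs_weight n I1 I2 I3 :
  #|I1| = n -> #|I2| = n -> #|I3| = n ->
  \sum_(w in I1) #|w| <= k -> \sum_(w in I2) #|w| <= k ->
  \sum_(w in I3) #|w| <= k ->
  6 * n <= 4 * k + 3 + (#|I1 :&: I2| + #|I1 :&: I3| + #|I2 :&: I3|).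
Proof.
move=> c1 c2 c3 /card_le_weight h1 /card_le_weight h2 /card_le_weight h3.
have sI A B : singletons (A :&: B) = singletons A :&: singletons B.
  by apply/setP=> q; rewrite !inE.
have := card_singletons (I1 :&: I2); have := card_singletons (I1 :&: I3).
have := card_singletons (I2 :&: I3); rewrite !sI !inE.
have : #|singletons I1 :|: singletons I2 :|: singletons I3| <= k.
  by rewrite -[k in _ <= k]card_ord max_card.
have := cardsUI (singletons I1 :|: singletons I2) (singletons I3).
have := cardsUI (singletons I1) (singletons I2).
have := cardsUI (singletons I1 :&: singletons I3) (singletons I2 :&: singletons I3).
rewrite setIUl.
move: h1 h2 h3; rewrite c1 c2 c3.
case: (set0 \in I1); case: (set0 \in I2); case: (set0 \in I3) => /=; lia.
Qed.

End Counting.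

(** * From strategies to sets of questions *)

Section LowerBound.

Variables (c : nat) (qs : seq (3.-tuple nat)).

(* The element [x] of ['I_c] stands for the color [x.+1]. *)
Definition asking (i : nat) (x : 'I_c) : {set 'I_(size qs)} :=
  [set q | nth 0 (tnth (in_tuple qs) q) i == x.+1].

(** A question has one color on peg [i], so it lies in at most one of the sets. *)
Lemma weight_asking i :
  injective (asking i) ->
  \sum_(w in [set asking i x | x in 'I_c]) #|w| <= size qs.
Proof.
move=> inj; rewrite big_imset /=; last by move=> x y _ _; apply: inj.
rewrite (eq_bigr (fun x : 'I_c => \sum_q (q \in asking i x))); last first.
  by move=> x _; rewrite -sum1_card big_mkcond; apply: eq_bigr => q _; case: ifP.
rewrite exchange_big /= -[leqRHS]card_ord -sum1_card; apply: leq_sum => q _.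
(* Color [n] is the element [n.-1]. If [n = 0], the element 0 is singled out instead, but the
   question then lies in no set and the bound still holds. *)
set n := nth 0 (tnth (in_tuple qs) q) i; have [lt|ge] := ltnP n.-1 c; last first.
  rewrite big1 // => x _; rewrite inE -/n; case: eqP => // e.
  by move: ge; rewrite e leqNgt ltn_ord.
rewrite (bigD1 (Ordinal lt)) //= big1 ?addn0 ?leq_b1 // => x ne.
rewrite inE -/n; case: eqP => // e; case/eqP: ne; apply: val_inj.
by rewrite /= e.
Qed.

Definition code_of (a b d : 'I_c) := code3 a.+1 b.+1 d.+1.

Lemma code_ofP a b d : uniq [:: a; b; d] -> is_code c (code_of a b d).
Proof.
rewrite !uniq3 /is_code /code_of /= !inE !eqSS !ltn_ord !andbT negb_or -andbA.
by [].
Qed.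

Lemma answer_sum (Q S : 3.-tuple nat) :
  answer Q S = \sum_i (tnth Q i == tnth S i).
Proof.
rewrite /answer -sum1_card big_mkcond; apply: eq_bigr => i _.
by rewrite inE; case: eqP.
Qed.

Lemma answer_asking (q : 'I_(size qs)) a b d :
  answer (tnth (in_tuple qs) q) (code_of a b d) =
    (q \in asking 0 a) + (q \in asking 1 b) + (q \in asking 2 d).
Proof.
rewrite answer_sum !big_ord_recr big_ord0 /= !inE add0n.
by rewrite !(tnth_nth 0).
Qed.

Lemma code_of_surj S :
  is_code c S -> exists a b d, S = code_of a b d.
Proof.
case/tupleP: S => s1 S; case/tupleP: S => s2 S; case/tupleP: S => s3 S.
rewrite tuple0 /is_code => /andP[_] /=; rewrite andbT.
case: s1 s2 s3 => [|s1] [|s2] [|s3] /and3P[] // h1 h2 h3.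
by exists (Ordinal h1), (Ordinal h2), (Ordinal h3); apply: val_inj.
Qed.

Lemma sumn_answers a b d :
  sumn [seq answer Q (code_of a b d) | Q <- qs] =
    #|asking 0 a| + #|asking 1 b| + #|asking 2 d|.
Proof.
rewrite sumnE big_map -{1}[qs]/(tval (in_tuple qs)) big_tuple.
rewrite (eq_bigr _ (fun q _ => answer_asking q a b d)) !big_split /=.
by congr (_ + _ + _); rewrite -sum1_card [RHS]big_mkcond; apply: eq_bigr => q _;
  case: (_ \in _).
Qed.

Hypothesis feas : feasible c qs.

(** The answer to a question counts those of the three sets of the code that contain it, so it
    depends only on their multiset. *)
Lemma asking_separating :
  separating (asking 0) (asking 1) (asking 2).
Proof.
move=> a1 a2 a3 b1 b2 b3 ua ub pab.
have [E|ne] := eqVneq (code_of a1 a2 a3) (code_of b1 b2 b3).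
  move/(congr1 val): E => [e1 e2 e3].
  by split; apply: val_inj.
case: (feas (code_ofP ua) (code_ofP ub) (elimN eqP ne)).
have eqt (S S' : 3.-tuple nat) :
    (forall q, answer (tnth (in_tuple qs) q) S = answer (tnth (in_tuple qs) q) S') ->
    [seq answer Q S | Q <- qs] = [seq answer Q S' | Q <- qs].
  move=> h; apply/eq_in_map=> Q /(nthP (code3 0 0 0))[j lj <-].
  by have := h (Ordinal lj); rewrite !(tnth_nth (code3 0 0 0)).
apply: eqt => q; rewrite !answer_asking.
move/permP: pab => /(_ (fun w : {set 'I_(size qs)} => q \in w)) /=.
by rewrite !addn0 !addnA.
Qed.

Lemma asking_inj i : 3 < c -> i < 3 -> injective (asking i).
Proof.
move=> c_gt3 i_lt3; have cT : 3 < #|'I_c| by rewrite card_ord.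
have sep := asking_separating; have sep' := separating_swap12 sep.
case: i i_lt3 => [|[|[|//]]] _; first exact: separating_inj cT sep.
- exact: separating_inj cT sep'.
- exact: separating_inj cT (separating_swap12 (separating_swap23 sep)).
Qed.

Lemma lower_bound_gt4 : 4 < c -> 6 * c <= 4 * size qs + 9.
Proof.
move=> c_gt4; have inj i := @asking_inj i (ltnW c_gt4).
have card_img i : i < 3 -> #|[set asking i x | x in 'I_c]| = c.
  by move=> /inj injf; rewrite card_imset ?card_ord.
have weight i : i < 3 -> \sum_(w in [set asking i x | x in 'I_c]) #|w| <= size qs.
  by move=> /inj; apply: weight_asking.
apply: leq_trans (three_pegs_weight (card_img 0 isT) (card_img 1 isT)
  (card_img 2 isT) (weight 0 isT) (weight 1 isT) (weight 2 isT)) _.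
rewrite -addnA leq_add2l (leq_add2l 3 _ 6).
by apply: card_common_sum asking_separating; rewrite card_ord.
Qed.

End LowerBound.

(** * The case of four colors *)

(** Besides [w] there are at least three sets, at most one of them empty, so they already weigh at
    least 2. *)
Lemma card_le1_of_weight_le3 k (I : {set {set 'I_k}}) w :
  3 < #|I| -> \sum_(v in I) #|v| <= 3 -> w \in I -> #|w| <= 1.
Proof.
move=> cI; rewrite (cardsD1 w) in cI; move=> + wI; rewrite wI in cI.
rewrite (big_setD1 w) //=.
have : #|I :\ w| <= \sum_(v in I :\ w) (#|v| + (v == set0)).
  rewrite -sum1_card; apply: leq_sum => v _; rewrite -cards_eq0; lia.
rewrite big_split /=.
have : \sum_(v in I :\ w) (v == set0) <= 1.
  have [w0|w0] := boolP (set0 \in I :\ w).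
    rewrite (big_setD1 set0) //= eqxx big1 // => v; rewrite !inE.
    by case/andP=> /negPf->.
  by rewrite big1 // => v vI; case: eqP => // v0; rewrite -v0 vI in w0.
move: cI; rewrite add1n; move: (\sum_(v in _) #|_|) (\sum_(v in _) _) => m n.
move: #|I :\ w| #|w| => p r; lia.
Qed.

Lemma lower_bound_eq4 (qs : seq (3.-tuple nat)) : feasible 4 qs -> 3 < size qs.
Proof.
move=> feas; rewrite ltnNge; apply/negP => le3.
have le1 i (x : 'I_4) : i < 3 -> #|asking qs i x| <= 1.
  move=> i3; have inj := asking_inj feas isT i3.
  apply: (@card_le1_of_weight_le3 _ [set asking qs i x | x in 'I_4]).
  - by rewrite card_imset ?card_ord.
  - exact: leq_trans (weight_asking inj) le3.
  - exact: imset_f.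
(* Here [D] lists the 24 codes and [L] the 20 triples of sum at most 3. Missing answers are padded
   with 0, so that [v] also covers fewer than three questions. Its injectivity on [D] would give 24
   <= 20. *)
pose D := [seq X <- [seq code3 p.1 p.2.1 p.2.2 |
  p <- allpairs pair (iota 1 4) (allpairs pair (iota 1 4) (iota 1 4))]
  | is_code 4 X].
pose v (X : 3.-tuple nat) :=
  let r := [seq answer Q X | Q <- qs] in (nth 0 r 0, (nth 0 r 1, nth 0 r 2)).
pose L := [seq p <- allpairs pair (iota 0 4) (allpairs pair (iota 0 4) (iota 0 4)) |
  p.1 + p.2.1 + p.2.2 <= 3].
have : size (map v D) <= size L; last by rewrite size_map.
have cD S : S \in D -> is_code 4 S by rewrite mem_filter => /andP[].
apply: uniq_leq_size.
  rewrite map_inj_in_uniq // => S S' /cD cS /cD cS' [h0 h1 h2].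
  apply/eqP; apply: contraT => /eqP ne; case: (feas _ _ cS cS' ne).
  apply: (@eq_from_nth _ 0); rewrite !size_map // => i lti.
  by have := leq_trans lti le3; case: i {lti} => [|[|[|i]]].
move=> p /mapP[S /cD /code_of_surj[a [b [d ->]]] ->].
have := sumn_answers qs a b d; rewrite /v; set r := map _ _.
have sr : size r <= 3 by rewrite size_map.
have la := @le1 0 a isT; have lb := @le1 1 b isT; have ld := @le1 2 d isT.
have <- : nth 0 r 0 + nth 0 r 1 + nth 0 r 2 = sumn r.
  by case: (r) sr => [|n1 [|n2 [|n3 [|? ?]]]] //= _; lia.
move=> sum_r; rewrite mem_filter; apply/andP; split; first by rewrite /=; lia.
by apply: allpairs_f; [|apply: allpairs_f]; rewrite mem_iota; lia.
Qed.

Lemma lower_bound c (qs : seq (3.-tuple nat)) :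
  4 <= c -> feasible c qs -> (3 * c - 1) %/ 2 - 1 <= size qs.
Proof.
rewrite leq_eqVlt => /predU1P[<- /lower_bound_eq4 // | c_gt4 /lower_bound_gt4].
by move/(_ c_gt4); lia.
Qed.

(** * Feasibility *)

(** A form of [answer] on plain sequences, which evaluates by computation and applies to partial
    codes. *)
Definition hits (Q X : seq nat) : nat := count (fun p => p.1 == p.2) (zip Q X).

Lemma answer_hits (Q S : 3.-tuple nat) : answer Q S = hits Q S.
Proof.
rewrite answer_sum !big_ord_recr big_ord0 /= !(tnth_nth 0).
case/tupleP: Q => q1 Q; case/tupleP: Q => q2 Q; case/tupleP: Q => q3 Q.
case/tupleP: S => s1 S; case/tupleP: S => s2 S; case/tupleP: S => s3 S.
by rewrite (tuple0 Q) (tuple0 S) /hits /= addn0 add0n addnA.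
Qed.

(* Partial codes: color [0] marks a peg left empty. *)
Definition partial_code (n : nat) (X : seq nat) : bool :=
  if X is [:: a; b; d] then
    [&& a <= n, b <= n, d <= n, (a == b) ==> (a == 0), (a == d) ==> (a == 0)
      & (b == d) ==> (b == 0)]
  else false.

Definition partial_codes (n : nat) : seq (seq nat) :=
  [seq X <- [seq p.1 :: p.2 |
    p <- allpairs pair (iota 0 n.+1)
      (allpairs (fun a b => [:: a; b]) (iota 0 n.+1) (iota 0 n.+1))]
   | partial_code n X].

Lemma mem_partial_codes n X : partial_code n X -> X \in partial_codes n.
Proof.
move=> pX; rewrite mem_filter pX; move: pX.
case: X => [|a [|b [|d [|? ?]]]] // /and4P[ha hb hd _].
apply/mapP; exists (a, [:: b; d]) => //; apply: allpairs_f.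
  by rewrite mem_iota ltnS.
by apply: allpairs_f; rewrite mem_iota ltnS.
Qed.

Definition window (d n x : nat) : nat := if d < x <= d + n then x - d else 0.

Lemma partial_code_window d n m X :
  partial_code m X -> partial_code n (map (window d n) X).
Proof.
case: X => [|a [|b [|c [|? ?]]]] //=; rewrite /window.
by repeat case: ifP; lia.
Qed.

Lemma hits_shift d n Q X : all (fun q => 0 < q <= n) Q ->
  hits (map (addn d) Q) X = hits Q (map (window d n) X).
Proof.
rewrite /hits; elim: Q X => [|q Q IH] [|x X] //= /andP[hq /IH ->].
by congr (_ + _); rewrite /window; case: ifP; lia.
Qed.

(** This turns injectivity on an explicit list into a Boolean test that can be evaluated. *)
Lemma uniq_map_inj_in (T U : eqType) (f : T -> U) (r : seq T) :
  uniq (map f r) -> {in r &, injective f}.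
Proof.
elim: r => //= x r IH /andP[fx /IH inj] a b; rewrite !inE.
case/predU1P=> [->|ar] /predU1P[->|br] //; last exact: inj.
  by move=> e; rewrite e map_f in fx.
by move=> e; rewrite -e map_f in fx.
Qed.

(** Base questions may confuse an empty peg with a color: for [t = 4] none has color 1 on peg 2. The
    set of empty pegs must therefore be known beforehand. *)
Definition blanks (X : seq nat) : seq bool := [seq x == 0 | x <- X].

Lemma block_determines X Y : partial_code 6 X -> partial_code 6 Y ->
  [seq hits Q X | Q : 3.-tuple nat <- block_questions] =
  [seq hits Q Y | Q : 3.-tuple nat <- block_questions] -> X = Y.
Proof.
move=> /mem_partial_codes pX /mem_partial_codes pY.
pose f Z := [seq hits Q Z | Q : 3.-tuple nat <- block_questions].
apply: (@uniq_map_inj_in _ _ f (partial_codes 6) _ X Y pX pY).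
by vm_compute.
Qed.

Lemma base_determines t X Y : 4 <= t <= 9 ->
  partial_code t X -> partial_code t Y -> blanks X = blanks Y ->
  [seq hits Q X | Q : 3.-tuple nat <- base_questions t] =
  [seq hits Q Y | Q : 3.-tuple nat <- base_questions t] -> X = Y.
Proof.
move=> ht /mem_partial_codes pX /mem_partial_codes pY bXY hXY.
pose f t Z := (blanks Z, [seq hits Q Z | Q : 3.-tuple nat <- base_questions t]).
have /allP/(_ t) u : all (fun t => uniq (map (f t) (partial_codes t))) (iota 4 6).
  by vm_compute.
apply: (@uniq_map_inj_in _ _ (f t) (partial_codes t) _ X Y pX pY).
  by apply: u; rewrite mem_iota; lia.
by rewrite /f bXY hXY.
Qed.

(** * The full list of questions, decoded block by block *)

Lemma questions0 t : questions 0 t = base_questions t.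
Proof. by rewrite /questions cats0. Qed.

Lemma questionsS s t :
  questions s.+1 t = questions s t ++ map (shift (6 * s + t)) block_questions.
Proof.
rewrite /questions -[s.+1]addn1 iotaD map_cat flatten_cat catA.
congr (_ ++ _); apply: etrans (cats0 _) _; congr (map (shift _) _); lia.
Qed.

Lemma is_code_leq p m n (S : p.-tuple nat) : m <= n -> is_code m S -> is_code n S.
Proof.
move=> le /andP[uS /allP aS]; rewrite /is_code uS; apply/allP => x /aS; lia.
Qed.

Lemma is_code_shift m d (Q : 3.-tuple nat) :
  is_code m Q -> is_code (d + m) (shift d Q).
Proof.
case/andP=> uQ /allP aQ; rewrite /is_code (map_inj_uniq (@addnI d)) uQ.
by apply/allP=> _ /mapP[x /aQ hx ->]; lia.
Qed.

Lemma questions_codes s t : 4 <= t <= 9 ->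
  all (is_code (6 * s + t)) (questions s t).
Proof.
move=> ht; elim: s => [|s IH].
  by rewrite questions0; case: t ht => [|[|[|[|[|[|[|[|[|[|t]]]]]]]]]].
rewrite questionsS all_cat; apply/andP; split.
  by apply: sub_all IH => Q; apply: is_code_leq; lia.
rewrite all_map; have : all (is_code 6) block_questions by [].
apply: sub_all => Q /(is_code_shift (6 * s + t)) /=.
by apply: is_code_leq; lia.
Qed.

Lemma questions_uniq s t : 4 <= t <= 9 -> uniq (questions s t).
Proof.
move=> ht; elim: s => [|s IH].
  by rewrite questions0; case: t ht => [|[|[|[|[|[|[|[|[|[|t]]]]]]]]]].
rewrite questionsS cat_uniq IH andTb; apply/andP; split.
  apply/hasPn => _ /mapP[Q Qin ->]; apply/negP => /(allP (questions_codes s ht)).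
  have : all (is_code 6) block_questions by [].
  move/allP/(_ Q Qin); case/tupleP: Q {Qin} => q Q.
  by rewrite /is_code /= => /andP[_ /andP[hq _]] /andP[_ /andP[hq' _]]; lia.
rewrite map_inj_uniq //.
by move=> Q Q' /(congr1 val) /(inj_map (@addnI _)) /val_inj.
Qed.

Lemma size_questions s t : size (questions s t) = size (base_questions t) + 9 * s.
Proof.
elim: s => [|s IH]; first by rewrite questions0 muln0 addn0.
by rewrite questionsS size_cat IH size_map /=; lia.
Qed.

Lemma hits_window n (qs : seq (3.-tuple nat)) X : all (is_code n) qs ->
  [seq hits Q (map (window 0 n) X) | Q : 3.-tuple nat <- qs] =
  [seq hits Q X | Q : 3.-tuple nat <- qs].
Proof.
move=> /allP cqs; apply/eq_in_map => Q /cqs/andP[_ aQ].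
by rewrite -hits_shift // (eq_map add0n) map_id.
Qed.

Lemma window_split d x y : x <= d + 6 -> y <= d + 6 ->
  window 0 d x = window 0 d y -> window d 6 x = window d 6 y -> x = y.
Proof. by rewrite /window; repeat case: ifP; lia. Qed.

Lemma window_blank d x : x <= d + 6 ->
  (window 0 d x == 0) = (x == 0) || (window d 6 x != 0).
Proof. by rewrite /window; repeat case: ifP; lia. Qed.

(** The induction runs over partial codes because pegs with a color of the last block look empty to
    the earlier questions. The last block is decoded first; it reveals these pegs, hence the blanks
    of the part left to the induction hypothesis. *)
Lemma questions_determine s t X Y : 4 <= t <= 9 ->
  partial_code (6 * s + t) X -> partial_code (6 * s + t) Y ->
  blanks X = blanks Y ->
  [seq hits Q X | Q : 3.-tuple nat <- questions s t] =
  [seq hits Q Y | Q : 3.-tuple nat <- questions s t] -> X = Y.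
Proof.
move=> ht; elim: s X Y => [|s IH] X Y.
  by rewrite questions0; apply: base_determines.
move=> pX pY bXY; rewrite questionsS !(map_cat _ (questions s t)) => /eqP.
set d := 6 * s + t; have sd : 6 * s.+1 + t = d + 6 by rewrite /d; lia.
rewrite sd in pX pY.
rewrite eqseq_cat ?size_map // => /andP[/eqP lowXY /eqP highXY].
have hb Z : [seq hits Q Z | Q : 3.-tuple nat <- map (shift d) block_questions] =
    [seq hits Q (map (window d 6) Z) | Q : 3.-tuple nat <- block_questions].
  rewrite -map_comp; apply/eq_in_map => Q Qin /=; apply: hits_shift.
  have /allP/(_ Q Qin)/andP[_] : all (is_code 6) block_questions by [].
  by apply: sub_all => q; lia.
rewrite !{}hb in highXY.
have high : map (window d 6) X = map (window d 6) Y.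
  by apply: block_determines highXY; apply: partial_code_window; eassumption.
have low : map (window 0 d) X = map (window 0 d) Y.
  apply: IH.
  - exact: partial_code_window pX.
  - exact: partial_code_window pY.
  - move: pX pY bXY high.
    case: X {lowXY highXY} => [|x1 [|x2 [|x3 [|? ?]]]] //=.
    case: Y => [|y1 [|y2 [|y3 [|? ?]]]] //=.
    move=> /and4P[? ? ? _] /and4P[? ? ? _] [b1 b2 b3] [h1 h2 h3].
    by rewrite /blanks /= !window_blank // b1 b2 b3 h1 h2 h3.
  - by rewrite !hits_window //; apply: questions_codes.
move: pX pY high low.
case: X {bXY lowXY highXY} => [|x1 [|x2 [|x3 [|? ?]]]] //=.
case: Y => [|y1 [|y2 [|y3 [|? ?]]]] //=.
move=> /and4P[? ? ? _] /and4P[? ? ? _] [h1 h2 h3] [l1 l2 l3].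
by congr [:: _; _; _]; apply: window_split; eassumption.
Qed.

Lemma is_code_partial c (S : 3.-tuple nat) :
  is_code c S -> partial_code c S /\ blanks S = [:: false; false; false].
Proof.
case/tupleP: S => s1 S; case/tupleP: S => s2 S; case/tupleP: S => s3 S.
rewrite tuple0 /is_code /blanks /= !inE; split; first lia.
by congr [:: _; _; _]; lia.
Qed.

Lemma questions_feasible s t : 4 <= t <= 9 -> feasible (6 * s + t) (questions s t).
Proof.
move=> ht S S' /is_code_partial[pS bS] /is_code_partial[pS' bS'] ne e.
apply/ne/val_inj; apply: (questions_determine ht pS pS'); first by rewrite bS bS'.
by rewrite -!(eq_map (fun Q => answer_hits Q _)).
Qed.

Theorem theorem2 (c : nat) (hc : 4 <= c) :
  (exists! st : nat * nat, c = 6 * st.1 + st.2 /\ 4 <= st.2 <= 9) /\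
  (forall s t : nat, c = 6 * s + t -> 4 <= t <= 9 ->
     [/\ size (questions s t) = (3 * c - 1) %/ 2 - 1,
         n_strategy c ((3 * c - 1) %/ 2) (questions s t),
         feasible c (questions s t) &
         optimal c (questions s t)]).
Proof.
split.
  (* Division of [c - 4] by 6 puts [t - 4] in the range of remainders. *)
  exists ((c - 4) %/ 6, (c - 4) %% 6 + 4); split=> [/=|[s t] /= [cE ht]]; first lia.
  by congr pair; lia.
move=> s t cE ht.
have sz : size (questions s t) = (3 * c - 1) %/ 2 - 1.
  rewrite size_questions cE.
  (* The base lists have 4, 6, 7, 9, 10 and 12 questions; six more colors raise the bound by 9, the
     size of a block. *)
  by case: t ht {cE} => [|[|[|[|[|[|[|[|[|[|t]]]]]]]]]] //= _; lia.
have feas : feasible c (questions s t) by rewrite cE; apply: questions_feasible.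
split=> //.
  split; last by rewrite sz; lia.
  by split; [rewrite cE; apply: questions_codes|apply: questions_uniq].
split=> // -[qs [_ /(lower_bound hc) le]]; rewrite sz; lia.
Qed.
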